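(* For $n=3$, the algorithm for Shifted Combinatorial Optimization over independence systems presented by a linear optimization oracle that is described in the context has approximation ratio $\frac{19}{42}$: for every independence system $S\subseteq\{0,1\}^d$ and every $c\in\mathbb{Z}^{d\times 3}$, it returns a matrix $y\in S^3$ with $c\,\overline{y}\ge \frac{19}{42}\max\{c\,\overline{z} : z\in S^3\}$.
   Context: For a matrix $x$, $x^j$ denotes its $j$-th column. $S^n$ is the set of $d\times n$ matrices all of whose columns lie in $S$. The shift $\overline{x}$ of $x$ is the unique matrix obtained by permuting entries within each row so that each row is nonincreasing; $cx:=\sum_{i,j}c_{i,j}x_{i,j}$. Shifted Combinatorial Optimization (SCO): given $S\subseteq\{0,1\}^d$ and $c\in\mathbb{Z}^{d\times n}$, solve $\max\{c\,\overline{x}:x\in S^n\}$. $S$ is an independence system if $0\in S$ and $u\le v\in S$, $u\in\{0,1\}^d$ imply $u\in S$. A linear optimization oracle for $S$, queried on $w\in\mathbb{Z}^d$, returns $s\in S$ maximizing $ws$. An algorithm has approximation ratio $\alpha\le 1$ if it always returns a feasible solution with objective value at least $\alpha$ times the optimum. Disjoint Union Problem (DUP) with $k$ columns and weights $w\in\mathbb{Z}^d$: $\max\{w\sum_{j=1}^k x^j : x\in S^k,\ \sum_{j=1}^k x^j\in\{0,1\}^d\}$. Greedy algorithm for DUP: successively for $r=1,\dots,k$ query the oracle on the weights obtained from $w$ by setting to $0$ the weights of elements covered by previously obtained vectors, obtaining $x^r\in S$; then in each row of $[x^1,\dots,x^k]$ change all $1$'s but the first to $0$. It has approximation ratio $1-(1-\frac1k)^k$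 for DUP with $k$ columns (so $\frac{19}{27}$ for $k=3$, and it is exact for $k=1$). Cleaning procedure applied to $x\in S^n$: for each $i\in\{1,\dots,d\}$ let $m(i,x)=\sum_j x_{i,j}$ and let $p(i,x)$ be a maximizer of $\sum_{j=1}^{r}c_{i,j}$ over $0\le r\le m(i,x)$; replace exactly $m(i,x)-p(i,x)$ of the $1$'s in row $i$ of $x$ by $0$'s. The algorithm for $n=3$ constructs two candidate solutions and returns the one with larger objective value $c\,\overline{x}$. Candidate $\ell=0$: apply the greedy algorithm to DUP with $k=3$ columns and weights $w_i=\max_{0\le q\le 1}\sum_{j=1}^q c_{i,j}$ and apply the cleaning procedure to the resulting $d\times 3$ matrix. Candidate $\ell=1$: solve exactly (by one oracle call) DUP with $k=1$ column and weights $w_i=\max_{0\le q\le 3}\sum_{j=1}^q c_{i,j}$, take three copies of the resulting column, and apply the cleaning procedure. *)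

(* Defs.v *)
From mathcomp Require Import all_boot all_order all_algebra.

Set Implicit Arguments.
Unset Strict Implicit.
Unset Printing Implicit Defensive.

Import Order.TTheory GRing.Theory Num.Theory.

Local Open Scope ring_scope.

(* 0/1 vectors and matrices are boolean matrices; a boolean entry is read as
   the integer 0 or 1 through the coercions bool >-> nat >-> int. *)

Definition cvdot d (w : 'cV[int]_d) (s : 'cV[bool]_d) : int :=
  \sum_i w i 0 * (s i 0)%:Z.

Definition mxdot d n (c : 'M[int]_(d, n)) (x : 'M[bool]_(d, n)) : int :=
  \sum_i \sum_j c i j * (x i j)%:Z.

Definition independence_system d (S : {set 'cV[bool]_d}) : Prop :=
  const_mx false \in S /\
  forall u v : 'cV[bool]_d,
    v \in S -> (forall i, (u i 0%R <= v i 0%R)%N) -> u \in S.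

Definition cols_in d n (S : {set 'cV[bool]_d}) : {set 'M[bool]_(d, n)} :=
  [set x | [forall j, col j x \in S]].

Definition row_seq d n (x : 'M[bool]_(d, n)) (i : 'I_d) : seq bool :=
  [seq x i j | j <- enum 'I_n].

Definition geqb (a b : bool) : bool := (b <= a)%N.

Definition shift d n (x : 'M[bool]_(d, n)) : 'M[bool]_(d, n) :=
  \matrix_(i, j) nth false (sort geqb (row_seq x i)) j.

Definition is_shift d n (x y : 'M[bool]_(d, n)) : Prop :=
  forall i, perm_eq (row_seq y i) (row_seq x i) /\ sorted geqb (row_seq y i).

Lemma row_seq_shift d n (x : 'M[bool]_(d, n)) i :
  row_seq (shift x) i = sort geqb (row_seq x i).
Proof.
have sz : size (sort geqb (row_seq x i)) = n.
  by rewrite size_sort size_map size_enum_ord.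
apply: (@eq_from_nth _ false); first by rewrite sz size_map size_enum_ord.
move=> k; rewrite size_map size_enum_ord => ltkn.
rewrite (nth_map (Ordinal ltkn)) ?size_enum_ord // mxE.
by rewrite (nth_enum_ord _ ltkn).
Qed.

Lemma shiftP d n (x y : 'M[bool]_(d, n)) : is_shift x y <-> y = shift x.
Proof.
have tot : total geqb by case; case.
have tr : transitive geqb by case; case; case.
have asym : antisymmetric geqb by case; case.
split=> [xy | -> i]; last first.
  by rewrite row_seq_shift perm_sort perm_refl sort_sorted.
apply/matrixP=> i j; have [pxy srt] := xy i.
have eq_rows : row_seq y i = row_seq (shift x) i.
  rewrite row_seq_shift; apply: (sorted_eq tr asym srt).
    exact: sort_sorted.
  by rewrite perm_sym perm_sort perm_sym.
have nthE z : nth false (@row_seq d n z i) j = z i j.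
  by rewrite (nth_map j) ?size_enum_ord // nth_ord_enum.
by rewrite -!nthE eq_rows.
Qed.

Definition sco_value d n (c : 'M[int]_(d, n)) (x : 'M[bool]_(d, n)) : int :=
  mxdot c (shift x).

(* The zero matrix, feasible for an independence system, seeds the arg max. *)
Definition sco_opt d n (S : {set 'cV[bool]_d}) (c : 'M[int]_(d, n)) : int :=
  sco_value c
    [arg max_(z > const_mx false in cols_in n S) sco_value c z]%O.

(* s is an admissible answer of a linear optimization oracle for S queried
   on w. Stating the oracle as a relation leaves the choice among several
   maximizers free, independently at each query. *)
Definition oracle_answer d (S : {set 'cV[bool]_d}) (w : 'cV[int]_d)
    (s : 'cV[bool]_d) : Prop :=
  s \in S /\ forall t, t \in S -> cvdot w t <= cvdot w s.

Definition covered_before d k (x : 'M[bool]_(d, k)) (r : 'I_k) (i : 'I_d) :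
    bool :=
  [exists j : 'I_k, (j < r)%N && x i j].

Definition residual_weights d k (w : 'cV[int]_d) (x : 'M[bool]_(d, k))
    (r : 'I_k) : 'cV[int]_d :=
  \col_i (if covered_before x r i then 0 else w i 0).

Definition keep_first d k (x : 'M[bool]_(d, k)) : 'M[bool]_(d, k) :=
  \matrix_(i, j) (x i j && ~~ covered_before x j i).

Definition greedy_dup d k (S : {set 'cV[bool]_d}) (w : 'cV[int]_d)
    (y : 'M[bool]_(d, k)) : Prop :=
  exists2 x : 'M[bool]_(d, k),
    forall r : 'I_k, oracle_answer S (residual_weights w x r) (col r x)
    & y = keep_first x.

Definition prefix_sum d n (c : 'M[int]_(d, n)) (i : 'I_d) (q : nat) : int :=
  \sum_(j < n | (j < q)%N) c i j.

Definition max_prefix_weights d n (c : 'M[int]_(d, n)) (m : nat) : 'cV[int]_d :=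
  \col_i \big[Num.max/prefix_sum c i 0]_(0 <= q < m.+1) prefix_sum c i q.

Definition row_mult d n (x : 'M[bool]_(d, n)) (i : 'I_d) : nat :=
  (\sum_j x i j)%N.

(* y results from x by the cleaning procedure, for some choice of the
   maximizers p and of the ones that are replaced. *)
Definition cleaning d n (c : 'M[int]_(d, n)) (x y : 'M[bool]_(d, n)) : Prop :=
  exists p : 'I_d -> nat, forall i,
    [/\ (p i <= row_mult x i)%N,
        forall r, (r <= row_mult x i)%N ->
          prefix_sum c i r <= prefix_sum c i (p i),
        forall j, y i j -> x i j
      & #|[set j | x i j && ~~ y i j]| = (row_mult x i - p i)%N].

Definition candidate0 d (S : {set 'cV[bool]_d}) (c : 'M[int]_(d, 3))
    (y : 'M[bool]_(d, 3)) : Prop :=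
  exists2 x : 'M[bool]_(d, 3),
    greedy_dup S (max_prefix_weights c 1) x & cleaning c x y.

(* With a single column the disjointness constraint of the Disjoint Union
   Problem is void, so an oracle answer is exactly an optimal solution. *)
Definition candidate1 d (S : {set 'cV[bool]_d}) (c : 'M[int]_(d, 3))
    (y : 'M[bool]_(d, 3)) : Prop :=
  exists2 s : 'cV[bool]_d,
    oracle_answer S (max_prefix_weights c 3) s
    & cleaning c (\matrix_(i < d, j < 3) s i 0) y.

Definition sco3_output d (S : {set 'cV[bool]_d}) (c : 'M[int]_(d, 3))
    (y : 'M[bool]_(d, 3)) : Prop :=
  exists y0 y1 : 'M[bool]_(d, 3),
    [/\ candidate0 S c y0, candidate1 S c y1
      & (y = y0 /\ sco_value c y1 <= sco_value c y0) \/
        (y = y1 /\ sco_value c y0 <= sco_value c y1)].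

(* An algorithm is given by its possible outputs: it must have one, and every
   one must be feasible and within the factor alpha of the optimum. *)
Definition has_approx_ratio d n (S : {set 'cV[bool]_d}) (c : 'M[int]_(d, n))
    (output : 'M[bool]_(d, n) -> Prop) (alpha : rat) : Prop :=
  (exists y, output y) /\
  forall y, output y ->
    y \in cols_in n S /\
    alpha * (sco_opt S c)%:~R <= (sco_value c y)%:~R.

(* Main.v *)
(* Write M_i(q) for the largest prefix sum of row i of c of length at most q,
   and m_i for the row sums of a matrix z in S^3. Cleaning a matrix x makes its
   value exactly sum_i M_i(row sum of x). Every greedy step gains at least a
   third of the part of U = sum_(m_i > 0) M_i(1) not yet covered, so the first
   candidate has value v0 with 27 v0 >= 19 U; the second has value v1 >= the
   average of M(3) z^j over the columns of z, so 3 v1 >= T = sum_i m_i M_i(3).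
   Monotonicity of M_i gives M_i(1) + m M_i(3) >= 2 M_i(m) for m = 1, 2, 3,
   hence U + T >= 2 c zbar and
   84 max(v0, v1) >= 27 v0 + 57 v1 >= 19 (U + T) >= 38 c zbar. *)

Require Import Defs.
From mathcomp Require Import all_boot all_order all_algebra.
From mathcomp Require Import zify lra.
Local Open Scope ring_scope.

Set Implicit Arguments.
Unset Strict Implicit.
Unset Printing Implicit Defensive.

Import Order.TTheory GRing.Theory Num.Theory.

(** * The shift and the objective in terms of row sums *)

Lemma sort_geqb (s : seq bool) :
  sort geqb s = nseq (count id s) true ++ nseq (count (predC id) s) false.
Proof.
have tot : total geqb by case; case.
have tr : transitive geqb by case; case; case.
have asym : antisymmetric geqb by case; case.
apply: (sorted_eq tr asym); first exact: sort_sorted.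
  rewrite sorted_pairwise //; elim: (count id s) => [|m IHm] /=.
    by elim: (count _ s) => //= m ->; rewrite andbT all_nseq orbT.
  by rewrite IHm andbT; apply/allP; case.
have filterE (a : pred bool) b : (forall x, a x -> x = b) ->
    filter a s = nseq (count a s) b.
  move=> ab; rewrite -size_filter; apply/all_pred1P/allP=> x.
  by rewrite mem_filter /= => /andP[/ab->].
rewrite perm_sort -!filterE; try by case.
by rewrite perm_sym perm_filterC.
Qed.

Lemma row_multE d n (x : 'M[bool]_(d, n)) i :
  row_mult x i = #|[pred j | x i j]|.
Proof.
rewrite /row_mult -sum1_card [RHS]big_mkcond.
by apply: eq_bigr => j _; rewrite inE; case: (x i j).
Qed.

Lemma shiftE d n (x : 'M[bool]_(d, n)) i j :
  shift x i j = (j < row_mult x i)%N.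
Proof.
rewrite mxE sort_geqb nth_cat size_nseq !nth_nseq if_same.
have -> : count id (row_seq x i) = row_mult x i.
  by rewrite row_multE count_map -sum1_count big_enum_cond -sum1_card.
by case: ltnP => // ->.
Qed.

(** Shifting moves the ones of each row to its front, so the objective depends on [x] through its
    row sums only. *)
Lemma sco_valueE d n (c : 'M[int]_(d, n)) x :
  sco_value c x = \sum_i prefix_sum c i (row_mult x i).
Proof.
apply: eq_bigr => i _; rewrite /prefix_sum [RHS]big_mkcond.
by apply: eq_bigr => j _; rewrite shiftE; case: ifP; rewrite ?mulr1 ?mulr0.
Qed.

Lemma row_mult_le d n (x : 'M[bool]_(d, n)) i : (row_mult x i <= n)%N.
Proof. by rewrite row_multE -[leqRHS]card_ord max_card. Qed.

(** * Maximal prefix sums and the cleaning procedure *)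

Section MaxPrefix.

Context (d n : nat) (c : 'M[int]_(d, n)).

Lemma prefix_sum_le_max i q m :
  (q <= m)%N -> prefix_sum c i q <= max_prefix_weights c m i 0.
Proof.
rewrite -ltnS => ltqm; rewrite mxE big_mkord.
exact: (le_bigmax _ (fun q : 'I_m.+1 => prefix_sum c i q) (Ordinal ltqm)).
Qed.

Lemma max_prefix_le i m (b : int) :
  (forall q, (q <= m)%N -> prefix_sum c i q <= b) ->
  max_prefix_weights c m i 0 <= b.
Proof.
move=> ub; rewrite mxE big_mkord; apply: bigmax_le; first exact: ub.
by move=> q _; apply: ub; rewrite -ltnS.
Qed.

Lemma max_prefix_mono i m m' : (m <= m')%N ->
  max_prefix_weights c m i 0 <= max_prefix_weights c m' i 0.
Proof.
move=> le_m; apply: max_prefix_le => q leqm.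
by apply: prefix_sum_le_max; apply: leq_trans le_m.
Qed.

Lemma prefix_sum0 i : prefix_sum c i 0 = 0.
Proof. by rewrite /prefix_sum big_pred0. Qed.

Lemma max_prefix_ge0 i m : 0 <= max_prefix_weights c m i 0.
Proof. by rewrite -(prefix_sum0 i) prefix_sum_le_max. Qed.

Lemma max_prefix0 i : max_prefix_weights c 0 i 0 = 0.
Proof.
apply/eqP; rewrite eq_le max_prefix_ge0 andbT.
by apply: max_prefix_le => q; rewrite leqn0 => /eqP->; rewrite prefix_sum0.
Qed.

Lemma sco_value_le_max x :
  sco_value c x <= \sum_i max_prefix_weights c (row_mult x i) i 0.
Proof.
by rewrite sco_valueE; apply: ler_sum => i _; apply: prefix_sum_le_max.
Qed.

(** Cleaning leaves [p i] ones in row [i]; which ones go does not matter, as only row sums count. *)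
Lemma sco_value_cleaning x y : cleaning c x y ->
  sco_value c y = \sum_i max_prefix_weights c (row_mult x i) i 0.
Proof.
case=> p clean; rewrite sco_valueE; apply: eq_bigr => i _.
have [le_p max_p sub_yx card_del] := clean i.
have -> : row_mult y i = p i.
  (* The ones of row [i] of [x] split into kept and deleted ones; [le_p] makes the truncated
     subtraction exact. *)
  have := cardsID [set j | y i j] [set j | x i j].
  have -> : [set j | x i j] :\: [set j | y i j] = [set j | x i j && ~~ y i j].
    by apply/setP=> j; rewrite !inE andbC.
  have -> : [set j | x i j] :&: [set j | y i j] = [set j | y i j].
    by apply/setIidPr/subsetP=> j; rewrite !inE; apply: sub_yx.
  by rewrite card_del !cardsE -!row_multE; lia.
apply/eqP; rewrite eq_le prefix_sum_le_max //=.
exact: max_prefix_le.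
Qed.

Lemma cleaning_exists x : exists y, cleaning c x y.
Proof.
have /fin_all_exists[p pP] i : exists p, (p <= row_mult x i)%N /\
    forall r, (r <= row_mult x i)%N -> prefix_sum c i r <= prefix_sum c i p.
  case: (@arg_maxP _ _ _ ord0 xpredT
    (fun p : 'I_(row_mult x i).+1 => prefix_sum c i p)) => // p _ max_p.
  exists p; split=> [|r]; first by rewrite -ltnS.
  by rewrite -ltnS => ltr; apply: (max_p (Ordinal ltr)).
(* The ones to keep: subsets of size [p i] are counted by a binomial coefficient, positive since
   [p i] is at most the row sum. *)
have /fin_all_exists[Y YP] i : exists A : {set 'I_n},
    A \subset [set j | x i j] /\ #|A| = p i.
  have : (0 < #|[set A : {set 'I_n} | A \subset [set j | x i j]
                 & #|A| == p i]|)%N.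
    by rewrite cards_draws bin_gt0 cardsE -row_multE; case: (pP i).
  case/card_gt0P=> A; rewrite inE => /andP[sub /eqP]; by exists A.
exists (\matrix_(i, j) (j \in Y i)), p => i.
have [[le_p max_p] [sub cardY]] := (pP i, YP i).
split=> // [j|].
  by rewrite mxE => /(subsetP sub); rewrite inE.
rewrite -cardY row_multE -(cardsE (fun j => x i j)).
have := cardsID (Y i) [set j | x i j]; rewrite (setIidPr sub) => <-.
rewrite addKn; apply: eq_card => j.
by rewrite !inE mxE andbC.
Qed.

End MaxPrefix.

(** * Oracle answers, feasibility and existence of a greedy run *)

Section Oracle.

Context (d : nat) (S : {set 'cV[bool]_d}).

Lemma cols_inP n (x : 'M[bool]_(d, n)) :
  reflect (forall j, col j x \in S) (x \in cols_in n S).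
Proof. by rewrite inE; apply: forallP. Qed.

Lemma sum_row_mult n (w : 'cV[int]_d) (z : 'M[bool]_(d, n)) :
  \sum_i w i 0 * (row_mult z i)%:Z = \sum_j cvdot w (col j z).
Proof.
rewrite exchange_big; apply: eq_bigr => i _ /=.
rewrite -mulr_sumr /row_mult -natz natr_sum; congr (_ * _).
by apply: eq_bigr => j _; rewrite mxE natz.
Qed.

(** Each of the [n] columns of [z] competes with [s]; summing by columns instead of rows adds up
    these comparisons. *)
Lemma oracle_answer_cols n w s (z : 'M[bool]_(d, n)) :
  oracle_answer S w s -> z \in cols_in n S ->
  \sum_i w i 0 * (row_mult z i)%:Z <= n%:Z * cvdot w s.
Proof.
move=> [_ max_s] /cols_inP zS; rewrite sum_row_mult.
rewrite -[n in n%:Z]card_ord mulrC -natz mulr_natr -sumr_const.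
by apply: ler_sum => j _; apply: max_s.
Qed.

Hypothesis HS : independence_system S.

Lemma oracle_answer_exists w : exists s, oracle_answer S w s.
Proof.
have [S0 _] := HS.
case: (@arg_maxP _ _ _ (const_mx false) [in S] (cvdot w)) => // s sS max_s.
by exists s; split.
Qed.

Lemma cols_in_sub n (x y : 'M[bool]_(d, n)) :
  (forall i j, y i j -> x i j) -> x \in cols_in n S -> y \in cols_in n S.
Proof.
move=> sub /cols_inP xS; apply/cols_inP=> j.
have [_ down] := HS; apply: (down _ _ (xS j)) => i; rewrite !mxE.
by case: (y i j) (sub i j) => [/(_ isT)->|].
Qed.

Lemma cleaning_cols_in n (c : 'M[int]_(d, n)) x y :
  cleaning c x y -> x \in cols_in n S -> y \in cols_in n S.
Proof.
case=> p clean; apply: cols_in_sub => i j.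
by have [_ _ sub _] := clean i; apply: sub.
Qed.

Lemma greedy_dup_exists k w : exists y : 'M[bool]_(d, k), greedy_dup S w y.
Proof.
(* Induction on the number [m] of correct columns: residual weights at [r] depend only on columns
   before [r], so overwriting column [m] spoils no earlier answer. *)
suff prefix m : exists x : 'M[bool]_(d, k), forall r : 'I_k, (r < m)%N ->
    oracle_answer S (residual_weights w x r) (col r x).
  by have [x xP] := prefix k; exists (keep_first x), x => // r; apply: xP.
elim: m => [|m [x IH]]; first by exists (const_mx false).
have [ltmk|lekm] := ltnP m k; last first.
  by exists x => r _; apply/IH/(leq_trans (ltn_ord r)).
pose rm := Ordinal ltmk.
have [s sP] := oracle_answer_exists (residual_weights w x rm).
exists (\matrix_(i, j) if j == rm then s i 0 else x i j) => r ltrm.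
set x' := (X in col r X).
have -> : residual_weights w x' r = residual_weights w x r.
  apply/matrixP=> i j; rewrite !mxE; congr (if _ then _ else _).
  apply: eq_existsb => l; have [ltlr|//] := ltnP l r.
  rewrite /= mxE; case: eqP => // l_rm; move: ltlr ltrm; rewrite l_rm /=; lia.
have [->|ne_r] := eqVneq r rm.
  have -> // : col rm x' = s.
  by apply/matrixP=> i j; rewrite !mxE eqxx (ord1 j).
have -> : col r x' = col r x.
  by apply/matrixP=> i j; rewrite !mxE (negPf ne_r).
by apply: IH; rewrite ltn_neqAle -ltnS ltrm andbT.
Qed.

End Oracle.

(** * Analysis of the greedy algorithm *)

Lemma row_mult_keep_first d k (x : 'M[bool]_(d, k)) i :
  [exists j, x i j] -> (0 < row_mult (keep_first x) i)%N.
Proof.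
case/existsP=> j0 xj0; rewrite row_multE; apply/card_gt0P.
(* The leftmost 1 of the row survives. *)
case: (@arg_minnP _ j0 (fun j => x i j) (@nat_of_ord k)) => // j xj min_j.
exists j; rewrite inE mxE xj /=; apply/existsP=> -[l /andP[ltlj xl]].
by move: (min_j l xl); rewrite leqNgt ltlj.
Qed.

Section Greedy.

Context (d k : nat) (S : {set 'cV[bool]_d}) (w : 'cV[int]_d).
Context (x : 'M[bool]_(d, k)).
Hypothesis w_ge0 : forall i, 0 <= w i 0.
Hypothesis greedy_x :
  forall r : 'I_k, oracle_answer S (residual_weights w x r) (col r x).

(** Unlike in [covered_before], [r] is a natural number, so that [r = k], the end of the run, is
    allowed. *)
Let covered r i := [exists j : 'I_k, (j < r)%N && x i j].
Let covered_weight r : int := \sum_(i | covered r i) w i 0.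

Lemma coveredS (r : 'I_k) i : covered r.+1 i = covered r i || x i r.
Proof.
apply/existsP/orP=> [[j /andP[]]|[/existsP[j /andP[ltjr xj]]|xr]].
- rewrite ltnS leq_eqVlt => /orP[/eqP/val_inj-> ->|ltjr xj]; first by right.
  by left; apply/existsP; exists j; rewrite ltjr.
- by exists j; rewrite ltnS ltnW.
- by exists r; rewrite ltnSn.
Qed.

(** Covered elements have residual weight 0, so the oracle value counts exactly the newly covered
    ones. *)
Lemma covered_weightS (r : 'I_k) :
  covered_weight r.+1 =
  covered_weight r + cvdot (residual_weights w x r) (col r x).
Proof.
rewrite /covered_weight big_mkcond [in RHS]big_mkcond -big_split.
apply: eq_bigr => i _.
rewrite !mxE coveredS -[covered_before x r i]/(covered r i) /=.
by case: (covered r i); case: (x i r); rewrite /= ?mulr1 ?mulr0 ?addr0 ?add0r.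
Qed.

Context (z : 'M[bool]_(d, k)).
Hypothesis zS : z \in cols_in k S.

Let support_weight : int := \sum_(i | (0 < row_mult z i)%N) w i 0.

(** Together the [k] columns of [z] meet every uncovered element of the support at least once, and
    weights are nonnegative. *)
Lemma greedy_gain (r : 'I_k) :
  support_weight - covered_weight r <=
  k%:Z * cvdot (residual_weights w x r) (col r x).
Proof.
apply: (le_trans _ (oracle_answer_cols (greedy_x r) zS)).
rewrite lerBlDr /support_weight /covered_weight big_mkcond.
rewrite [X in _ + X]big_mkcond -big_split.
apply: ler_sum => i _; rewrite mxE -[covered_before x r i]/(covered r i) /=.
have := w_ge0 i; case: (row_mult z i) => [|m] w0.
  all: by case: (covered r i) => /=; nia.
Qed.

(** Each step shrinks the bound on the uncovered weight by the factor [1 - 1/k]; denominators are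
    cleared to stay in [int]. *)
Lemma greedy_deficit r : (r <= k)%N ->
  k%:Z ^+ r * (support_weight - covered_weight r) <=
  (k%:Z - 1) ^+ r * support_weight.
Proof.
elim: r => [_|r IHr ltrk].
  rewrite !expr0 !mul1r lerBlDr lerDl.
  by apply: sumr_ge0 => i _; apply: w_ge0.
have := IHr (ltnW ltrk); have := greedy_gain (Ordinal ltrk).
rewrite (covered_weightS (Ordinal ltrk)) /=.
set g := cvdot _ _ => gain IH.
have k_ge1 : 0 <= k%:Z - 1 by lia.
rewrite [in leRHS]exprS -mulrA.
apply: (le_trans _ (ler_wpM2l k_ge1 IH)).
(* Without the common factor [k ^+ r], what remains is [gain]. *)
rewrite exprSr -mulrA [leRHS]mulrCA ler_wpM2l ?exprn_ge0 //.
rewrite mulrBl mul1r mulrBr mulrDr mulrBr; lia.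
Qed.

End Greedy.

(** The case [r = k] of the deficit bound. The columns of [z] may overlap: greedy is compared with
    the weight of their union. *)
Lemma greedy_dup_bound d k (S : {set 'cV[bool]_d}) (w : 'cV[int]_d)
    (y z : 'M[bool]_(d, k)) :
  (forall i, 0 <= w i 0) -> greedy_dup S w y -> z \in cols_in k S ->
  k%:Z ^+ k * (\sum_(i | (0 < row_mult z i)%N) w i 0
               - \sum_(i | (0 < row_mult y i)%N) w i 0) <=
  (k%:Z - 1) ^+ k * \sum_(i | (0 < row_mult z i)%N) w i 0.
Proof.
move=> w_ge0 [x greedy_x ->] zS.
apply: (le_trans _ (greedy_deficit w_ge0 greedy_x zS (leqnn k))).
rewrite ler_wpM2l ?exprn_ge0 // lerD2l lerN2.
rewrite big_mkcond [leRHS]big_mkcond; apply: ler_sum => i _.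
case: ifP => [/existsP[j /andP[_ xj]]|_]; last by case: ifP.
by rewrite row_mult_keep_first //; apply/existsP; exists j.
Qed.

Lemma greedy_dup_cols_in d k (S : {set 'cV[bool]_d}) (w : 'cV[int]_d)
    (y : 'M[bool]_(d, k)) :
  independence_system S -> greedy_dup S w y -> y \in cols_in k S.
Proof.
move=> HS [x greedy_x ->]; apply: (cols_in_sub HS (x := x)) => [i j|].
  by rewrite mxE => /andP[].
by apply/cols_inP=> j; case: (greedy_x j).
Qed.

(** * Bounds for the two candidates and the final ratio *)

Lemma candidate0_bound d (S : {set 'cV[bool]_d}) c y z :
  candidate0 S c y -> z \in cols_in 3 S ->
  19 * \sum_(i | (0 < row_mult z i)%N) max_prefix_weights c 1 i 0 <=
  27 * sco_value c y.
Proof.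
case=> x greedy_x clean zS.
have := greedy_dup_bound (fun i => max_prefix_ge0 c i 1) greedy_x zS.
have : \sum_(i | (0 < row_mult x i)%N) max_prefix_weights c 1 i 0 <=
    sco_value c y.
  rewrite (sco_value_cleaning clean) big_mkcond.
  apply: ler_sum => i _; case: ifP => [m_gt0|_]; last exact: max_prefix_ge0.
  exact: max_prefix_mono.
(* For [k = 3] the factors are 27 and 8, and [19 = 27 - 8]. *)
lia.
Qed.

(** Three copies of [s] have row sums 3 on its support, so the cleaned value is at least the oracle
    value of [s]. *)
Lemma candidate1_bound d (S : {set 'cV[bool]_d}) c y z :
  candidate1 S c y -> z \in cols_in 3 S ->
  \sum_i max_prefix_weights c 3 i 0 * (row_mult z i)%:Z <= 3 * sco_value c y.
Proof.
case=> s oracle_s clean zS.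
apply: le_trans (oracle_answer_cols oracle_s zS) _.
rewrite ler_wpM2l // (sco_value_cleaning clean).
apply: ler_sum => i _.
have -> : row_mult (\matrix_(i < d, j < 3) s i 0) i = (3 * s i 0%R)%N.
  by rewrite /row_mult -[RHS]mulnC !big_ord_recl big_ord0 !mxE; case: (s i 0).
case: (s i 0); rewrite ?mulr1 // mulr0; exact: max_prefix_ge0.
Qed.

Theorem theorem5p4 (d : nat) (S : {set 'cV[bool]_d}) (c : 'M[int]_(d, 3))
  (HS : independence_system S) :
  has_approx_ratio S c (sco3_output S c) (19%:Q / 42%:Q).
Proof.
split=> [|y [y0 [y1 [cand0 cand1 out]]]].
  have [x0 greedy_x0] := greedy_dup_exists HS 3 (max_prefix_weights c 1).
  have [y0 clean0] := cleaning_exists c x0.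
  have [s oracle_s] := oracle_answer_exists HS (max_prefix_weights c 3).
  have [y1 clean1] := cleaning_exists c (\matrix_(i < d, j < 3) s i 0).
  have cand0 : candidate0 S c y0 by exists x0.
  have cand1 : candidate1 S c y1 by exists s.
  have [le10|/ltW le01] := leP (sco_value c y1) (sco_value c y0).
    by exists y0, y0, y1; split=> //; left.
  by exists y1, y0, y1; split=> //; right.
split.
  have y0S : y0 \in cols_in 3 S.
    have [x greedy_x clean] := cand0.
    exact: (cleaning_cols_in HS clean (greedy_dup_cols_in HS greedy_x)).
  have y1S : y1 \in cols_in 3 S.
    have [s [sS _] clean] := cand1.
    apply: (cleaning_cols_in HS clean); apply/cols_inP=> j.
    have -> // : col j (\matrix_(i < d, j < 3) s i 0) = s.
    by apply/matrixP=> i k; rewrite !mxE (ord1 k).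
  by case: out => -[-> _].
have zero_in : const_mx false \in cols_in 3 S.
  apply/cols_inP=> j; have [S0 _] := HS.
  have -> // : col j (const_mx false) = const_mx false :> 'cV[bool]_d.
  by apply/matrixP=> i k; rewrite !mxE.
rewrite /sco_opt; case: (arg_maxP _ zero_in) => z zS _.
have bound0 := candidate0_bound cand0 zS.
have bound1 := candidate1_bound cand1 zS.
have opt_le : 2 * sco_value c z <=
    \sum_(i | (0 < row_mult z i)%N) max_prefix_weights c 1 i 0 +
    \sum_i max_prefix_weights c 3 i 0 * (row_mult z i)%:Z.
  apply: (le_trans (ler_wpM2l _ (sco_value_le_max c z))) => //.
  rewrite mulr_sumr [in leRHS]big_mkcond -big_split; apply: ler_sum => i _.
  (* With [M] the maximal prefix sums of the row, [M(1) + m M(3) >= 2 M(m)] holds for [m = 0] by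
     [M(0) = 0], for [m = 1] by [M(1) <= M(3)], for [m = 2] by [M(2) <= M(3)] and [M(1) >= 0], and
     for [m = 3] by nonnegativity. *)
  have := max_prefix_ge0 c i 1; have := max_prefix_mono c i (isT : 1 <= 3)%N.
  have := max_prefix_mono c i (isT : 2 <= 3)%N; have := max_prefix0 c i.
  case: (row_mult z i) (row_mult_le z i) => [|[|[|[|m]]]] //= _; lia.
have : 19 * sco_value c z <= 42 * sco_value c y.
  by case: out => -[-> le_y]; lia.
rewrite -(ler_int rat) !rmorphM /=; lra.
Qed.
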